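(* Let $(\Omega,\mathcal{B},P)$ be a probability space with $\mathcal{B}$ countably generated, let $\mathcal{A}\subset\mathcal{B}$ be a sub-$\sigma$-field, and let $\mu$ be a fixed regular conditional distribution for $P$ given $\mathcal{A}$. Suppose that $G=\{(x,y)\in\Omega\times\Omega:H(x)=H(y)\}$ belongs to $\mathcal{B}\otimes\mathcal{B}$. Consider the condition (3* ) there is $B_0\in\mathcal{A}^*$ with $P(B_0)=1$ and $\mu(\omega)(H(\omega))\in\{0,1\}$ for all $\omega\in B_0$. Then condition (3* ) implies $S\in\sigma(\mathcal{A}\cup\mathcal{N})$. Moreover, if $S\in\sigma(\mathcal{A}\cup\mathcal{N})$, then condition (3* ) and the following conditions (b* ) and (c* ) are all equivalent: (b* ) $\mathcal{A}\cap V$ is countably generated for some $V\in\mathcal{A}^*$ with $V\subset S$ and $P(S-V)=0$; (c* ) $\mathcal{A}\cap V=\mathcal{A}^*\cap V$ for some $V\in\mathcal{A}^*$ with $V\subset S$ and $P(S-V)=0$.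
   Context: Let $\mathbb{P}$ be the set of probability measures on $\mathcal{B}$. A regular conditional distribution for $P$ given $\mathcal{A}$ is a map $\mu:\Omega\to\mathbb{P}$ such that, for all $B\in\mathcal{B}$, the function $\omega\mapsto\mu(\omega)(B)$ is a version of $E(I_B\mid\mathcal{A})$ (in particular it is $\mathcal{A}$-measurable). A $\sigma$-field is countably generated if it is generated by one of its countable subclasses. For a $\sigma$-field $\mathcal{F}$ on $\Omega$ and $V\subset\Omega$, $\mathcal{F}\cap V=\{F\cap V:F\in\mathcal{F}\}$ is the trace $\sigma$-field on $V$. $H(\omega)=\bigcap_{\omega\in A\in\mathcal{A}}A$ is the atom of $\mathcal{A}$ including $\omega$. $\mathcal{A}^*=\{B\in\mathcal{B}:B\text{ is a union of }\mathcal{A}\text{-atoms}\}$. $\mathcal{N}=\{B\in\mathcal{B}:P(B)=0\}$. Under the hypothesis $G\in\mathcal{B}\otimes\mathcal{B}$ one has $H(\omega)\in\mathcal{B}$ for all $\omega$; put $f(\omega)=\mu(\omega)(H(\omega))$ and $S=\{f>0\}=\{\omega\in\Omega:f(\omega)>0\}$. *)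

(* Defs.v *)
From HB Require Import structures.
From mathcomp Require Import all_boot all_order all_algebra.
From mathcomp Require Import all_classical all_reals all_analysis.
From mathcomp Require Import measurable_realfun.

Set Implicit Arguments.
Unset Strict Implicit.
Unset Printing Implicit Defensive.

Import Order.TTheory GRing.Theory Num.Theory.
Import numFieldNormedType.Exports.

Local Open Scope classical_set_scope.
Local Open Scope ring_scope.
Local Open Scope ereal_scope.

(* [F] is meant to be a sigma-algebra on [D]; the generating class is required
   to be a subclass of [F]. *)
Definition countably_generated {T : Type} (D : set T) (F : set (set T)) : Prop :=
  exists C : set (set T), [/\ countable C, C `<=` F & F = <<s D, C >>].

Definition atom {T : Type} (A : set (set T)) (w : T) : set T :=
  \bigcap_(X in [set X | A X /\ X w]) X.

Definition atom_unions {d : measure_display} {T : measurableType d}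
    (A : set (set T)) : set (set T) :=
  [set B | measurable B /\ exists W : set T, B = \bigcup_(w in W) atom A w].

Section conditional.
Context {d : measure_display} {T : measurableType d} {R : realType}.
Implicit Types (P : probability T R) (A : set (set T)).

(* [g] is a version of E(f | A), for an integrable [f] and a sub-sigma-algebra
   [A]; as <<s A >> = A, measurability from [g_sigma_algebraType A] is
   A-measurability. *)
Definition is_cond_expectation P A (f g : T -> \bar R) : Prop :=
  [/\ @measurable_fun _ _ (g_sigma_algebraType A) (\bar R) setT g,
      P.-integrable setT g &
      forall X, A X -> \int[P]_(x in X) g x = \int[P]_(x in X) f x].

Definition regular_cond_distribution P A (mu : T -> probability T R) : Prop :=
  forall B, measurable B ->
    is_cond_expectation P A (fun w => (\1_B w)%:E) (fun w => mu w B).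

Definition null_sets P : set (set T) := [set B | measurable B /\ P B = 0].

Definition charged_atoms A (mu : T -> probability T R) : set T :=
  [set w | 0 < mu w (atom A w)].

Definition zero_one_on_atoms P A (mu : T -> probability T R) : Prop :=
  exists B0, [/\ atom_unions A B0, P B0 = 1 &
    forall w, B0 w -> mu w (atom A w) = 0 \/ mu w (atom A w) = 1].

Definition trace_countably_generated P A (mu : T -> probability T R) : Prop :=
  exists V, [/\ atom_unions A V, V `<=` charged_atoms A mu,
    P (charged_atoms A mu `\` V) = 0 & countably_generated V (strace A V)].

Definition trace_eq_atom_unions P A (mu : T -> probability T R) : Prop :=
  exists V, [/\ atom_unions A V, V `<=` charged_atoms A mu,
    P (charged_atoms A mu `\` V) = 0 & strace A V = strace (atom_unions A) V].

End conditional.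

(* Main.v *)
Require Import Defs.
From HB Require Import structures.
From mathcomp Require Import all_boot all_order all_algebra.
From mathcomp Require Import all_classical all_reals all_analysis.
From mathcomp Require Import finmap measurable_realfun.
Set Implicit Arguments.
Unset Strict Implicit.
Unset Printing Implicit Defensive.

Import Order.TTheory GRing.Theory Num.Theory.

Local Open Scope classical_set_scope.

(* For a.e. w the measure mu w sees every set of the completion of A as trivial:
   mu w-a.e. y lies on the same side of it as w, and this holds simultaneously
   for countably many sets.
   Under (3* ), X = {w | mu w X = 1} on V = S `&` B0 for every union X of atoms,
   so A and A* have the same trace on V as the countably generated sigma(mu).
   This gives (b* ) and (c* ).  Moreover, if mu w charges S, then it charges S at
   some y with mu y = mu w and mu y (atom A y) = 1, so mu w S is a.e. 0 or 1 and
   S is a.e. equal to {w | mu w S = 1}.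
   Conversely, once S is in the completion, (3* ) follows as soon as countably many
   sets of A separate the atoms inside V, for then a.e. w in S has mu w
   concentrated on V and on the points not separated from w.  Under (b* ), such
   sets are lifts of the generators.  Under (c* ), they are lifts of the level
   sets of w |-> mu w B and w |-> mu w (B `&` atom A w), with B in a countable
   pi-system: if these functions agree at x and y but the atoms are disjoint, then
   mu x (atom A x) = mu x (atom A x `&` atom A y) = 0, which is impossible on S. *)

(** * Atoms of a sigma-algebra and saturated measurable sets *)

Section atoms.
Context {T : Type} {A : set (set T)}.
Hypothesis sA : sigma_algebra [set: T] A.

Lemma sigma_algebra_setC X : A X -> A (~` X).
Proof. by case: sA => _ + _ => /[apply]; rewrite setTD. Qed.

Lemma atom_refl w : atom A w w.
Proof. by move=> X []. Qed.

(** Membership is symmetric because [A] is closed under complement: a set of [A] containing [y] but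
    not [x] would have a complement containing [x] and hence [y]. *)
Lemma atomP x y : atom A x y <-> atom A x = atom A y.
Proof.
split=> [xy|->]; last exact: atom_refl.
have yx : atom A y x.
  move=> X /= [AX Xy]; apply: contrapT => nXx.
  by apply: (xy (~` X)) Xy; split => //; exact: sigma_algebra_setC.
apply/seteqP; split=> z zP X [AX Xw]; apply: zP; split => //.
- exact: yx.
- exact: xy.
Qed.

End atoms.

(** Saturation is the form in which unions of atoms are used below; a saturated [B] is the union of
    the atoms of its own points. *)
Lemma atom_unionsP (d : measure_display) (T : measurableType d)
    (A : set (set T)) (B : set T) : sigma_algebra [set: T] A ->
  atom_unions A B <->
  measurable B /\ (forall x y, atom A x = atom A y -> B x -> B y).
Proof.
move=> sA; split=> [[mB [W BE]]|[mB satB]].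
  split=> // x y xy; rewrite BE => -[w Ww /(atomP sA) wx]; exists w => //.
  by apply/(atomP sA); rewrite wx.
split=> //; exists B; apply/seteqP; split=> [x Bx|y [x Bx /(atomP sA) xy]].
  by exists x => //; exact: atom_refl.
exact: satB xy Bx.
Qed.

Lemma sub_atom_unions (d : measure_display) (T : measurableType d)
    (A : set (set T)) : sigma_algebra [set: T] A -> A `<=` measurable ->
  A `<=` atom_unions A.
Proof.
move=> sA mA X AX; apply/(atom_unionsP _ sA); split; first exact: mA.
by move=> x y /(atomP sA) + Xx; apply.
Qed.

(** * Superlevel sets at rational thresholds *)

Section rational_levels.
Context {T : Type} {R : realType}.
Local Open Scope ereal_scope.

Lemma exists_rat_between (r : R) (a : \bar R) :
  r%:E < a -> exists q : rat, (r < ratr q)%R /\ (ratr q)%:E < a.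
Proof.
move: a => [a| |] //.
- rewrite lte_fin => /rat_in_itvoo[q]; rewrite in_itv/= => /andP[rq qa].
  by exists q; rewrite lte_fin.
- move=> _; have /rat_in_itvoo[q] : (r < r + 1)%R by rewrite ltrDl.
  by rewrite in_itv/= => /andP[rq _]; exists q; rewrite ltry.
Qed.

Definition rational_levels (F : set (T -> \bar R)) : set (set T) :=
  \bigcup_(q in [set: rat]) (fun g => [set w | (ratr q)%:E < g w]) @` F.

Lemma countable_rational_levels (F : set (T -> \bar R)) :
  countable F -> countable (rational_levels F).
Proof.
move=> cF; apply: bigcup_countable => [|q _]; first exact: countableP.
exact: card_le_trans (card_image_le _ _) cF.
Qed.

(** Extended reals lying above the same rationals are equal. Nonnegativity makes the smaller of two
    unequal values real, as [exists_rat_between] asks. *)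
Lemma rational_levels_eq (F : set (T -> \bar R)) (x y : T) :
  (forall g w, F g -> 0 <= g w) ->
  (forall X, rational_levels F X -> X x <-> X y) ->
  forall g, F g -> g x = g y.
Proof.
move=> F0 lxy g Fg; have lg q : (ratr q)%:E < g x <-> (ratr q)%:E < g y.
  by apply: (lxy [set w | (ratr q)%:E < g w]); exists q => //; exists g.
have le (u v : \bar R) : (forall q, (ratr q)%:E < u -> (ratr q)%:E < v) ->
    0 <= v -> u <= v.
  move=> uv v0; rewrite leNgt; apply/negP => vu.
  case: v => [r| |] in uv v0 vu *; last by [].
    have [q [rq qu]] := exists_rat_between vu.
    by have := uv q qu; rewrite lte_fin ltNge (ltW rq).
  by move: vu; rewrite ltNge leey.
apply/eqP; rewrite eq_le; apply/andP; split; apply: le (F0 _ _ Fg);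
  by move=> q /lg.
Qed.

End rational_levels.

Lemma measurable_rational_levels (T : pointedType) (R : realType)
    (F : set (T -> \bar R)) (g : T -> \bar R) : F g ->
  @measurable_fun _ _ (g_sigma_algebraType (rational_levels F)) (\bar R)
    setT g.
Proof.
move=> Fg; apply: (measurability _ (ErealGenOInfty.measurableE R)).
move=> _ [_ [r ->] <-]; rewrite setTI.
(* A real threshold is approached from above by rationals, so its superlevel set is a countable
   union of rational ones. *)
rewrite [X in measurable X](_ : _ = \bigcup_(q in [set q : rat | (r < ratr q)%R])
    [set w | ((ratr q)%:E < g w)%E]).
  rewrite bigcup_mkcond; apply: bigcupT_measurable_rat => q.
  case: ifP => // _; apply: sub_sigma_algebra.
  by exists q => //; exists g.
apply/seteqP; split=> w /=.
  by rewrite in_itv/= andbT => /exists_rat_between[q [rq qw]]; exists q.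
by move=> [q /= rq qw]; rewrite in_itv/= andbT (lt_trans _ qw)//.
Qed.

(** * Countable families: almost-everywhere statements and generators *)

Lemma ae_countable (d : measure_display) (T : measurableType d) (R : realType)
    (m : {measure set T -> \bar R}%R) (I : Type) (C : set I)
    (Q : I -> T -> Prop) : countable C ->
  (forall i, C i -> {ae m, forall x, Q i x}) ->
  {ae m, forall x, forall i, C i -> Q i x}.
Proof.
move=> /pfcard_geP[->|[e]] CQ; first by apply: aeW => x i [].
have : {ae m, forall x, forall n, Q (e n) x}.
  by apply: ae_foralln => n; apply: CQ; exact: funS.
apply: filterS => x Qx i Ci; have [n _ <-] := (@surj _ _ _ _ e) i Ci.
exact: Qx.
Qed.

(** Finite intersections of the countably many generators; the empty intersection supplies
    [setT]. *)
Lemma countable_pi_system (d : measure_display) (T : measurableType d) :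
  countably_generated [set: T] measurable -> exists G : set (set T),
    [/\ countable G, setI_closed G, G setT & @measurable d T = <<s G >>].
Proof.
move=> [C [cC CD DE]]; exists (finI_from C id); split.
- exact: finI_from_countable.
- by move=> X Y; exact: finI_fromI.
- exists fset0; first by move=> x; rewrite inE.
  by rewrite set_fset0 bigcap_set0.
- rewrite {1}DE; apply/seteqP; split; apply: smallest_sub.
  + exact: smallest_sigma_algebra.
  + by move=> X CX; apply: sub_sigma_algebra; exact: finI_from1.
  + exact: smallest_sigma_algebra.
  + move=> _ [B BC <-]; rewrite -DE; apply: fin_bigcap_measurable => // X XB.
    by apply: CD; exact: set_mem (BC X XB).
Qed.

(** * Almost-sure properties of a regular conditional distribution *)

Section regular_conditional_distribution.
Context {d : measure_display} {T : measurableType d} {R : realType}.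
Variables (P : probability T R) (A : set (set T)) (mu : T -> probability T R).
Hypotheses (sA : sigma_algebra [set: T] A) (mA : A `<=` @measurable d T).
Hypothesis mu_rcd : regular_cond_distribution P A mu.
Local Open Scope ereal_scope.

Lemma rcd_preimage B U : measurable B -> measurable U ->
  A [set w | U (mu w B)].
Proof.
move=> mB mU; have [+ _ _] := mu_rcd mB.
by move=> /(_ measurableT U mU); rewrite setTI measurable_g_measurableTypeE.
Qed.

Lemma measurable_rcd B : measurable B ->
  measurable_fun [set: T] (fun w => mu w B).
Proof. by move=> mB _ U mU; rewrite setTI; apply: mA; exact: rcd_preimage. Qed.

(** The set of [w] with [mu w B = mu x B] is in [A] and contains [x], so it contains the whole atom
    of [x]. *)
Lemma rcd_atom x y : atom A x = atom A y ->
  forall B, measurable B -> mu x B = mu y B.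
Proof.
move=> /(atomP sA) xy B mB; apply/esym.
have := xy [set w | mu w B = mu x B]; apply; split => //.
by apply: (@rcd_preimage _ [set mu x B]) => //; exact: emeasurable_set1.
Qed.

Lemma integral_rcd X B : A X -> measurable B ->
  \int[P]_(w in X) mu w B = P (B `&` X).
Proof.
by move=> AX mB; have [_ _ ->//] := mu_rcd mB; rewrite integral_indic//; exact: mA.
Qed.

Lemma rcd_ae_eq0 X B : A X -> measurable B -> P (B `&` X) = 0 ->
  {ae P, forall w, X w -> mu w B = 0}.
Proof.
move=> AX mB; rewrite -integral_rcd// => PBX.
apply/(ae_eq_integral_abs P (mA AX) (f := fun w => mu w B)).
  exact: measurable_funTS (measurable_rcd mB).
by rewrite -[RHS]PBX; apply: eq_integral => w _; rewrite gee0_abs.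
Qed.

Lemma rcd_eq0 X B : A X -> measurable B -> (forall w, X w -> mu w B = 0) ->
  P (B `&` X) = 0.
Proof.
by move=> AX mB XB; rewrite -integral_rcd// integral0_eq.
Qed.

(** If [N] is a null set outside which [Q] holds, [mu w N] is nonnegative with integral [P N = 0],
    so it vanishes for a.e. [w]. *)
Lemma rcd_ae (Q : set T) : {ae P, forall x, Q x} ->
  {ae P, forall w, {ae mu w, forall y, Q y}}.
Proof.
move=> [N [mN PN QN]].
have AT : A [set: T] by rewrite -setC0; apply: sigma_algebra_setC; case: sA.
have : {ae P, forall w, [set: T] w -> mu w N = 0}.
  by apply: rcd_ae_eq0 => //; rewrite setIT.
by apply: filterS => w /(_ I) wN; exists N.
Qed.

(** The sets with this property form a sigma-algebra, so sets of [A] and null sets suffice. For [X]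
    in [A], the mass that [mu w] gives to the complement of [X] integrates to zero over [X], and
    likewise with the roles exchanged. *)
Lemma rcd_ae_iff X : <<s A `|` null_sets P >> X ->
  {ae P, forall w, {ae mu w, forall y, X y <-> X w}}.
Proof.
move: X; apply: smallest_sub.
  split.
  - by apply: aeW => w; apply: aeW.
  - move=> X; apply: filterS => w; apply: filterS => y.
    by rewrite setTD /setC/= => ->.
  - move=> F /ae_foralln; apply: filterS => w /ae_foralln.
    by apply: filterS => y Fyw; split=> -[n _ /Fyw Fn]; exists n.
have ae0 X B : A X -> measurable B -> P (B `&` X) = 0 ->
    {ae P, forall w, {ae mu w, forall y, X w -> ~ B y}}.
  move=> AX mB PBX; have := rcd_ae_eq0 AX mB PBX.
  apply: filterS => w wB; have [/wB {}wB|nXw] := pselect (X w); last exact: aeW.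
  by exists B; split => // y /= /not_implyP[_] /contrapT.
move=> X [AX|[mX PX]].
- have X1 := ae0 _ _ AX (measurableC (mA AX)) _.
  have X2 := ae0 _ _ (sigma_algebra_setC sA AX) (mA AX) _.
  move: X1 X2; rewrite setICl setICr measure0 => /(_ erefl) + /(_ erefl).
  apply: filterS2 => w; apply: filterS2 => y Xy nXy.
  by split=> [Xy'|/Xy/contrapT//]; apply: contrapT => /nXy; exact.
- have X0 : {ae P, forall x, ~ X x} by exists X; split => // x /= /contrapT.
  move: (rcd_ae X0) (X0); apply: filterS2 => w + nXw.
  by apply: filterS => y nXy.
Qed.

Lemma rcd_ae_iff_countable (C : set (set T)) : countable C -> C `<=` A ->
  {ae P, forall w, {ae mu w, forall y, forall X, C X -> X y <-> X w}}.
Proof.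
move=> cC CA.
have : {ae P, forall w, forall X, C X -> {ae mu w, forall y, X y <-> X w}}.
  apply: ae_countable => // X CX; apply: rcd_ae_iff.
  by apply: sub_sigma_algebra; left; exact: CA.
by apply: filterS => w; exact: ae_countable.
Qed.

(** Outside a null set [N] the two sets agree, and the part of [Y] inside [N] is itself a measurable
    null set. *)
Lemma completion_ae_eq X Y : <<s A `|` null_sets P >> X -> measurable Y ->
  {ae P, forall w, X w <-> Y w} -> <<s A `|` null_sets P >> Y.
Proof.
move=> sX mY [N [mN PN XYN]].
have sN B : measurable B -> B `<=` N -> <<s A `|` null_sets P >> B.
  move=> mB BN; apply: sub_sigma_algebra; right; split => //.
  by apply: (subset_measure0 mB mN BN PN).
have -> : Y = (X `\` N) `|` (Y `&` N).
  apply/seteqP; split=> w.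
    move=> Yw; have [Nw|nNw] := pselect (N w); [by right|left; split=> //].
    by apply: contrapT => nXw; apply/nNw/XYN => /= -[_ /(_ Yw)].
  move=> [[Xw nNw]|[]//].
  by apply: contrapT => nYw; apply/nNw/XYN => /= -[/(_ Xw)].
pose S := g_sigma_algebraType (A `|` null_sets P).
apply: (@measurableU _ S); last by apply: sN; [exact: measurableI|exact: subIsetr].
by apply: (@measurableD _ S) => //; exact: sN.
Qed.

Lemma measurable_rcd_xsection (U : set (T * T)) : measurable U ->
  measurable_fun [set: T] (fun w => mu w (xsection U w)).
Proof.
move=> mU.
(* Viewing [mu] as a kernel gives access to the measurability of section masses, proved for kernels
   by a monotone-class argument. *)
pose K := @isKernel.Build _ _ T T R (fun w => mu w : {measure set T -> \bar R}%R)
  measurable_rcd.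
pose k : (R.-ker T ~> T)%R :=
  HB.pack (fun w => mu w : {measure set T -> \bar R}%R) K.
have [|_] := @measurable_prod_subset_xsection_kernel _ _ T T R k _ measurableT _ _ mU.
  (* The required bound is strict, so 1 would not do. *)
  move=> w; exists 2%R => X mX; rewrite /mrestr/= setIT.
  by rewrite (le_lt_trans (probability_le1 _ _))// lte_fin ltr1n.
by under eq_fun do rewrite /mrestr/= setIT.
Qed.

End regular_conditional_distribution.

(** * Trace sigma-algebras and events of full probability *)

Lemma strace_g_sigma_algebra (T : Type) (C : set (set T)) (V : set T) :
  strace <<s C >> V = <<s V, strace C V >>.
Proof.
apply/seteqP; split=> [_ [X sX <-]|].
  (* The sets whose trace on [V] lies in the right-hand side form a sigma-algebra containing [C]. *)
  move: X sX; apply: smallest_sub; last first.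
    by move=> X CX; apply: sub_sigma_algebra; exists X.
  have [V0 VD VU] := smallest_sigma_algebra V (strace C V); split.
  - by rewrite set0I.
  - move=> X /VD; congr (_ _); apply/seteqP; split=> w /=.
      by move=> [Vw nXV]; split => //; split => // Xw; exact: nXV.
    by move=> [[_ nX] Vw]; split => // -[].
  - by move=> F /VU; rewrite setI_bigcupl.
apply: smallest_sub.
  by apply: sigma_algebra_strace; exact: smallest_sigma_algebra.
by apply: subset_strace; exact: sub_gen_smallest.
Qed.

Lemma emeasurable_gt (R : realType) (r : \bar R) :
  measurable [set x : \bar R | (r < x)%E].
Proof. by rewrite -[X in measurable X]setTI; exact: emeasurable_fun_o_infty. Qed.

Lemma probability_eq1P (d : measure_display) (T : measurableType d)
    (R : realType) (m : probability T R) (B : set T) : measurable B ->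
  (m B = 1)%E <-> {ae m, forall y, B y}.
Proof.
move=> mB; have mBC := probability_setC m mB; split=> [mB1|].
  exists (~` B); split => //; first exact: measurableC.
  by rewrite mBC mB1 subee.
move=> aeB; have mBC0 : (m (~` B) = 0)%E.
  exact: (measure_negligible (measurableC mB)).
by rewrite -[B]setCK probability_setC; [rewrite mBC0 sube0|exact: measurableC].
Qed.

(** * Masses of atoms and the sigma-algebra generated by [mu] *)

Section charged_atoms.
Context {d : measure_display} {T : measurableType d} {R : realType}.
Variables (P : probability T R) (A : set (set T)) (mu : T -> probability T R).
Hypotheses (sA : sigma_algebra [set: T] A) (mA : A `<=` @measurable d T).
Hypothesis mu_rcd : regular_cond_distribution P A mu.
Hypothesis G_measurable :
  measurable [set xy : T * T | atom A xy.1 = atom A xy.2].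
Variable Gen : set (set T).
Hypotheses (cGen : countable Gen) (GenI : setI_closed Gen) (GenT : Gen setT).
Hypothesis GenE : @measurable d T = <<s Gen >>.
Local Open Scope ereal_scope.
Local Notation S := (charged_atoms A mu).

Let measurable_Gen B : Gen B -> measurable B.
Proof. by move=> GB; rewrite GenE; exact: sub_sigma_algebra. Qed.

(** This is where measurability of the relation of having equal atoms enters: atoms become sections
    of a product-measurable set. *)
Lemma atomI_xsection (B : set T) w : B `&` atom A w =
  xsection ([set xy | atom A xy.1 = atom A xy.2] `&` (setT `*` B)) w.
Proof.
rewrite xsectionE; apply/seteqP; split=> y /=.
  by move=> [By /(atomP sA)].
by move=> [/(atomP sA) ? []].
Qed.

Lemma measurable_atom w : measurable (atom A w).
Proof.
rewrite -[atom A w]setTI atomI_xsection; apply: measurable_xsection.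
by apply: measurableI => //; exact: measurableX.
Qed.

Lemma rcd_atomI_unions B U : measurable B -> measurable U ->
  atom_unions A [set w | U (mu w (B `&` atom A w))].
Proof.
move=> mB mU; apply/(atom_unionsP _ sA); split.
  under eq_set do rewrite atomI_xsection.
  have mGB := measurableI _ _ G_measurable (measurableX (@measurableT _ T) mB).
  have := measurable_rcd_xsection sA mA mu_rcd mGB measurableT mU.
  by rewrite setTI.
move=> x y xy /=; rewrite xy (rcd_atom sA mu_rcd xy)//.
exact: measurableI (measurable_atom y).
Qed.

Lemma charged_atoms_unions : atom_unions A S.
Proof.
have := rcd_atomI_unions (@measurableT _ T) (emeasurable_gt (0 : \bar R)).
by under eq_set do rewrite setTI.
Qed.

(** A countable subclass of [A] generating sigma(mu), the smallest sigma-algebra making every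
    [mu w B] measurable in [w]. *)
Definition rcd_levels : set (set T) :=
  rational_levels ((fun B w => mu w B) @` Gen).

Lemma countable_rcd_levels : countable rcd_levels.
Proof.
apply: countable_rational_levels.
exact: card_le_trans (card_image_le _ _) cGen.
Qed.

Lemma rcd_levels_sub : rcd_levels `<=` A.
Proof.
move=> _ [q _ [_ [B GB <-] <-]].
exact: (rcd_preimage sA mu_rcd (measurable_Gen GB) (emeasurable_gt _)).
Qed.

Lemma eq_measure_Gen (m1 m2 : {measure set T -> \bar R}%R) :
  m1 setT < +oo -> (forall B, Gen B -> m1 B = m2 B) ->
  forall B, measurable B -> m1 B = m2 B.
Proof.
move=> m1T m12 B mB.
(* The measures are finite and [Gen] contains [setT], so a constant sequence exhausts the space. *)
apply: (measure_unique Gen (fun=> setT)) => //.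
by rewrite bigcup_const//; exists 0%N.
Qed.

Lemma rcd_levels_eq x y : (forall X, rcd_levels X -> X x <-> X y) ->
  forall B, measurable B -> mu x B = mu y B.
Proof.
move=> lxy; apply: eq_measure_Gen; first by rewrite ltey_eq fin_num_measure.
move=> B GB.
have F0 : forall g w, ((fun B w => mu w B) @` Gen) g -> 0 <= g w.
  by move=> _ w [C _ <-].
exact: (rational_levels_eq F0 lxy (imageP (fun B w => mu w B) GB)).
Qed.

(** Dynkin induction from the pi-system [Gen]: complements give [1 - mu w C], disjoint unions give
    countable sums. *)
Lemma measurable_rcd_levels B : measurable B ->
  @measurable_fun _ _ (g_sigma_algebraType rcd_levels) (\bar R) setT
    (fun w => mu w B).
Proof.
pose X := g_sigma_algebraType rcd_levels.
rewrite GenE => sB.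
pose Q (B : set T) := @measurable_fun _ _ X (\bar R) setT (fun w => mu w B).
apply: (@dynkin_induction _ T Gen Q GenE GenI) sB.
- rewrite /Q; under eq_fun do rewrite probability_setT.
  exact: measurable_cst.
- by move=> C GC; apply: measurable_rational_levels; exists C.
- move=> C mC QC; rewrite /Q; under eq_fun do rewrite probability_setC//.
  by apply: (@emeasurable_funB _ X) => //; exact: measurable_cst.
- move=> F mF tF QF; rewrite /Q.
  under eq_fun do rewrite measure_bigcup//.
  apply: (@ge0_emeasurable_sum _ X R setT (fun n w => mu w (F n))) => n *.
    exact: measure_ge0.
  exact: QF.
Qed.

Lemma rcd_levels_g_sub : <<s rcd_levels >> `<=` A.
Proof. by apply: smallest_sub => //; exact: rcd_levels_sub. Qed.

(** * Consequences of the zero-one condition *)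

Lemma zero_one_completion : zero_one_on_atoms P A mu ->
  <<s A `|` null_sets P >> S.
Proof.
move=> [B0 [/(atom_unionsP _ sA)[mB0 _] PB0 B01]].
have /(atom_unionsP _ sA)[mS satS] := charged_atoms_unions.
have muS01 : {ae P, forall w, mu w S = 0 \/ mu w S = 1}.
  have /(rcd_ae sA mA mu_rcd) := (probability_eq1P P mB0).1 PB0.
  have := rcd_ae_iff_countable sA mA mu_rcd countable_rcd_levels rcd_levels_sub.
  apply: filterS2 => w wlev wB0.
  have [|nmuS0] := pselect (mu w S = 0); [by left|right].
  (* For such [w], [mu w]-a.e. point lies in [B0] and shares all levels with [w]; positive mass of
     [S] puts one of these in [S]. Then [mu w S] is at least
     [mu w (atom A y) = mu y (atom A y) = 1]. *)
  have [y [B0y levy Sy]] : exists y, [/\ B0 y,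
      forall X, rcd_levels X -> X y <-> X w & S y].
    apply: contrapT => nex; apply: nmuS0; apply/(negligibleP _ mS).
    rewrite -[S]setCK.
    move: wlev wB0; apply: filterS2 => y ylev B0y Sy.
    by apply: nex; exists y.
  have [fy0|fy1] := B01 y B0y; first by move: Sy; rewrite /S/= fy0 ltxx.
  apply/eqP; rewrite eq_le probability_le1//= -fy1.
  rewrite (rcd_levels_eq levy (measurable_atom y)).
  apply: le_measure; [exact/mem_set/measurable_atom|exact: mem_set|].
  by move=> z /(atomP sA) yz; exact: satS yz Sy.
have AD : A [set w | mu w S = 1].
  exact: (rcd_preimage sA mu_rcd mS (emeasurable_set1 1)).
have AZ : A [set w | mu w S = 0].
  exact: (rcd_preimage sA mu_rcd mS (emeasurable_set1 0)).
apply: (@completion_ae_eq _ _ _ _ _ [set w | mu w S = 1]) => //.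
  by apply: sub_sigma_algebra; left.
(* Integrating the conditional mass of [S] where it is 0, and that of its complement where
   [mu w S = 1], shows that both mismatches are null. *)
have SZ : {ae P, forall w, ~ (S `&` [set w | mu w S = 0]) w}.
  exists (S `&` [set w | mu w S = 0]); split.
  - by apply: measurableI => //; exact: mA.
  - exact: (rcd_eq0 mA mu_rcd).
  - by move=> w /= /contrapT.
have SD : {ae P, forall w, ~ (~` S `&` [set w | mu w S = 1]) w}.
  exists (~` S `&` [set w | mu w S = 1]); split.
  - by apply: measurableI; [exact: measurableC|exact: mA].
  - apply: (rcd_eq0 mA mu_rcd AD (measurableC mS)) => w /= wS.
    by rewrite probability_setC// wS subee.
  - by move=> w /= /contrapT.
move: muS01 SZ SD; apply: filterS3 => w w01 nSZ nSD.
split=> [wS1|Sw]; first by apply: contrapT => nSw; exact: nSD.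
by case: w01 => // wS0; exfalso; exact: nSZ.
Qed.

Lemma zero_one_trace : zero_one_on_atoms P A mu ->
  exists V, [/\ atom_unions A V, V `<=` S, P (S `\` V) = 0 &
    strace (atom_unions A) V `<=` strace <<s rcd_levels >> V].
Proof.
move=> [B0 [/(atom_unionsP _ sA)[mB0 satB0] PB0 B01]].
have /(atom_unionsP _ sA)[mS satS] := charged_atoms_unions.
have mV : measurable (S `&` B0) by exact: measurableI.
exists (S `&` B0); split.
- apply/(atom_unionsP _ sA); split=> // x y xy [Sx B0x].
  by split; [exact: satS xy Sx|exact: satB0 xy B0x].
- exact: subIsetl.
- have := (probability_eq1P P mB0).1 PB0.
  move=> /(measure_negligible (measurableC mB0)).
  apply: (subset_measure0 (measurableD mS mV) (measurableC mB0)).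
  by move=> w [Sw nV] B0w; apply: nV.
- move=> _ [X /(atom_unionsP _ sA)[mX satX] <-].
  (* On [V] the measure [mu w] is concentrated on the atom of [w], which lies inside [X] or misses
     it according to whether [w] is in [X]. *)
  exists [set w | mu w X = 1].
    have := measurable_rcd_levels mX measurableT (emeasurable_set1 (1 : \bar R)).
    by rewrite setTI.
  have atom1 w : (S `&` B0) w -> {ae mu w, forall y, atom A w y}.
    move=> [Sw B0w]; apply/(probability_eq1P _ (measurable_atom w)).
    by have [fw0|//] := B01 w B0w; move: Sw; rewrite /S/= fw0 ltxx.
  apply/seteqP; split=> w /= [Xw Vw]; split=> //.
    apply: contrapT => nXw.
    suff : mu w X = 0 by rewrite Xw => /eqP; rewrite onee_eq0.
    apply/(negligibleP _ mX); rewrite -[X]setCK.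
    move: (atom1 w Vw); apply: filterS => y /(atomP sA) wy Xy.
    by apply: nXw; apply: satX Xy.
  apply/(probability_eq1P _ mX); move: (atom1 w Vw); apply: filterS => y /(atomP sA) wy.
  exact: satX wy Xw.
Qed.

Lemma zero_one_trace_countably_generated :
  zero_one_on_atoms P A mu -> trace_countably_generated P A mu.
Proof.
move=> /zero_one_trace[V [uV VS PSV trV]]; exists V; split => //.
exists (strace rcd_levels V); split.
- exact: card_le_trans (card_image_le _ _) countable_rcd_levels.
- by apply: subset_strace; exact: rcd_levels_sub.
(* The trace of [A] is squeezed between the traces of [<<s rcd_levels >>] and of [atom_unions A],
   and [trV] closes the circle. *)
- rewrite -strace_g_sigma_algebra; apply/seteqP; split.
    by apply: subset_trans trV; apply: subset_strace; exact: sub_atom_unions.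
  by apply: subset_strace; exact: rcd_levels_g_sub.
Qed.

Lemma zero_one_trace_eq_atom_unions :
  zero_one_on_atoms P A mu -> trace_eq_atom_unions P A mu.
Proof.
move=> /zero_one_trace[V [uV VS PSV trV]]; exists V; split => //.
apply/seteqP; split; first by apply: subset_strace; exact: sub_atom_unions.
by apply: subset_trans trV _; apply: subset_strace; exact: rcd_levels_g_sub.
Qed.

(** * Recovering the zero-one condition from countable separation of atoms *)

Lemma separated_zero_one (V : set T) (C : set (set T)) :
  <<s A `|` null_sets P >> S -> measurable V -> V `<=` S -> P (S `\` V) = 0 ->
  countable C -> C `<=` A ->
  (forall x y, V x -> V y -> (forall X, C X -> X x <-> X y) ->
    atom A x = atom A y) ->
  zero_one_on_atoms P A mu.
Proof.
move=> sS mV VS PSV cC CA sepC.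
have /(atom_unionsP _ sA)[mS _] := charged_atoms_unions.
have SV : {ae P, forall w, S w -> V w}.
  exists (S `\` V); split => //; first exact: measurableD.
  by move=> w /= /not_implyP.
have f01 : {ae P, forall w, mu w (atom A w) = 0 \/ mu w (atom A w) = 1}.
  move: (rcd_ae_iff_countable sA mA mu_rcd cC CA) (rcd_ae_iff sA mA mu_rcd sS).
  have : {ae P, forall w, (S w -> V w) /\ {ae mu w, forall y, S y -> V y}}.
    by move: SV (rcd_ae sA mA mu_rcd SV); apply: filterS2 => w.
  apply: filterS3 => w [SVw wSV] wC wS.
  (* Off [S] the atom has mass zero. On [S], [mu w]-a.e. [y] is in [S] because [S] is in the
     completion, hence in [V], and is not separated from [w] by [C]. *)
  have [Sw|/negP] := pselect (S w); last first.
    by rewrite -leNgt measure_le0 => /eqP; left.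
  right; apply/(probability_eq1P _ (measurable_atom w)).
  move: wSV wC wS; apply: filterS3 => y SVy yC ySw; apply/(atomP sA)/esym.
  by apply: sepC => //; [exact/SVy/ySw|exact: SVw].
have m01 : measurable ([set 0] `|` [set 1] : set (\bar R)).
  by apply: measurableU; exact: emeasurable_set1.
have := rcd_atomI_unions (@measurableT _ T) m01.
under eq_set do rewrite setTI; move=> u01.
exists [set w | ([set 0] `|` [set 1]) (mu w (atom A w))]; split => //.
by apply/probability_eq1P => //; have /(atom_unionsP _ sA)[] := u01.
Qed.

(** Choosing for each set of [D] a set of [A] with the same trace keeps the separation of points of
    [V]. *)
Lemma trace_lift (D : set (set T)) (V : set T) : countable D ->
  strace D V `<=` strace A V -> exists C : set (set T),
  [/\ countable C, C `<=` A & forall x y, V x -> V y ->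
    (forall X, C X -> X x <-> X y) -> forall X, D X -> X x <-> X y].
Proof.
move=> cD DA.
have /choice[g gP] : forall Y, exists X, D Y -> A X /\ X `&` V = Y `&` V.
  move=> Y; have [DY|nDY] := pselect (D Y); last by exists set0.
  have [|X AX XY] := DA (Y `&` V); first by exists Y.
  by exists X.
exists (g @` D); split.
- exact: card_le_trans (card_image_le _ _) cD.
- by move=> _ [Y /gP[]+ _ <-].
- move=> x y Vx Vy gxy Y DY; have [_ /seteqP[gY Yg]] := gP Y DY.
  have [gxy1 gxy2] := gxy (g Y) (imageP g DY).
  split=> Yw.
    by have /gxy1 gy := (Yg x (conj Yw Vx)).1; have [] := gY y (conj gy Vy).
  by have /gxy2 gx := (Yg y (conj Yw Vy)).1; have [] := gY x (conj gx Vx).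
Qed.

Lemma trace_countably_generated_zero_one : <<s A `|` null_sets P >> S ->
  trace_countably_generated P A mu -> zero_one_on_atoms P A mu.
Proof.
move=> sS [V [/(atom_unionsP _ sA)[mV _] VS PSV [C0 [cC0 C0A AE]]]].
have [] := @trace_lift C0 V cC0.
  move=> _ [Y C0Y <-]; have [X AX <-] := C0A Y C0Y.
  by exists X => //; rewrite -setIA setIid.
move=> C [cC CA CC0]; apply: (separated_zero_one sS mV VS PSV cC CA).
move=> x y Vx Vy Cxy; have C0xy := CC0 x y Vx Vy Cxy.
(* Not separating [x] from [y] is stable under the sigma-algebra operations on [V], so it passes
   from the generators to the whole trace. *)
have Vxy : forall X, strace A V X -> X x <-> X y.
  rewrite AE; apply: smallest_sub => //; split.
  - by [].
  - by move=> X Xxy; split=> -[_ nX]; split => // /Xxy.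
  - by move=> F Fxy; split=> -[n _ /Fxy Fn]; exists n.
apply/(atomP sA) => X /= [AX Xx].
by have [+ _] := Vxy (X `&` V) (ex_intro2 _ _ X AX erefl); move=> /(_ (conj Xx Vx))[].
Qed.

Lemma trace_eq_atom_unions_zero_one : <<s A `|` null_sets P >> S ->
  trace_eq_atom_unions P A mu -> zero_one_on_atoms P A mu.
Proof.
move=> sS [V [/(atom_unionsP _ sA)[mV _] VS PSV AE]].
pose F := rational_levels ((fun B w => mu w (B `&` atom A w)) @` Gen).
have cF : countable F.
  by apply: countable_rational_levels; exact: card_le_trans (card_image_le _ _) cGen.
have FA : F `<=` atom_unions A.
  move=> _ [q _ [_ [B GB <-] <-]].
  exact: rcd_atomI_unions (measurable_Gen GB) (emeasurable_gt _).
(* The sets of [F] are only known to be unions of atoms; equality of the traces provides their lifts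
   in [A]. *)
have [] := @trace_lift (rcd_levels `|` F) V.
- rewrite -bigcup2E; apply: bigcup_countable => [|[|[|n]] _] //=.
  exact: countable_rcd_levels.
- rewrite AE; apply: subset_strace => X [lX|/FA//].
  by apply: sub_atom_unions => //; exact: rcd_levels_sub.
move=> C [cC CA CF]; apply: (separated_zero_one sS mV VS PSV cC CA).
move=> x y Vx Vy Cxy; have lFxy := CF x y Vx Vy Cxy.
have muxy : forall B, measurable B -> mu x B = mu y B.
  by apply: rcd_levels_eq => X lX; apply: lFxy; left.
(* Both sides are finite measures in [B]. On [Gen], agreement on [F] yields the mass under [mu y] on
   the right, and [muxy] turns it into the mass under [mu x]. *)
have muIxy : forall B, measurable B ->
    mu x (B `&` atom A x) = mu x (B `&` atom A y).
  apply: (@eq_measure_Gen (mrestr (mu x) (measurable_atom x))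
    (mrestr (mu x) (measurable_atom y))).
    rewrite /= /mrestr/= setTI ltey_eq fin_num_measure//.
    exact: measurable_atom.
  move=> B GB; rewrite /mrestr/= [RHS]muxy; last first.
    by apply: measurableI; [exact: measurable_Gen|exact: measurable_atom].
  have F0 : forall g w, ((fun B w => mu w (B `&` atom A w)) @` Gen) g -> 0 <= g w.
    by move=> _ w [D _ <-].
  have lF : forall X, F X -> X x <-> X y by move=> X FX; apply: lFxy; right.
  exact: (rational_levels_eq F0 lF
    (imageP (fun B w => mu w (B `&` atom A w)) GB)).
apply: contrapT => nxy.
(* With [B] the atom of [x], the right-hand side is the mass of the intersection of two distinct,
   hence disjoint, atoms. *)
have /eqP := muIxy _ (measurable_atom x).
rewrite setIid (_ : _ `&` _ = set0) ?measure0.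
  by move=> /eqP fx0; have := VS x Vx; rewrite /S/= fx0 ltxx.
apply/seteqP; split=> // z [/(atomP sA) xz /(atomP sA) yz].
by apply: nxy; rewrite xz yz.
Qed.

End charged_atoms.

Theorem theorem8 (d : measure_display) (T : measurableType d) (R : realType)
    (P : probability T R) (A : set (set T)) (mu : T -> probability T R)
    (B_countably_generated : countably_generated [set: T] (@measurable d T))
    (A_sigma_algebra : sigma_algebra [set: T] A)
    (A_sub : A `<=` @measurable d T)
    (mu_rcd : regular_cond_distribution P A mu)
    (G_measurable :
       measurable [set xy : T * T | atom A xy.1 = atom A xy.2]) :
  (zero_one_on_atoms P A mu ->
     <<s A `|` null_sets P >> (charged_atoms A mu)) /\
  (<<s A `|` null_sets P >> (charged_atoms A mu) ->
     (zero_one_on_atoms P A mu <-> trace_countably_generated P A mu) /\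
     (zero_one_on_atoms P A mu <-> trace_eq_atom_unions P A mu)).
Proof.
have [Gen [cGen GenI GenT GenE]] := countable_pi_system B_countably_generated.
have e1 := zero_one_completion A_sigma_algebra A_sub mu_rcd G_measurable
  cGen GenI GenT GenE.
have e2 := zero_one_trace_countably_generated A_sigma_algebra A_sub mu_rcd
  G_measurable cGen GenI GenE.
have e3 := zero_one_trace_eq_atom_unions A_sigma_algebra A_sub mu_rcd
  G_measurable GenI GenE.
have e4 := trace_countably_generated_zero_one A_sigma_algebra A_sub mu_rcd
  G_measurable.
have e5 := trace_eq_atom_unions_zero_one A_sigma_algebra A_sub mu_rcd
  G_measurable cGen GenI GenT GenE.
split=> // sS; split.
- by split=> // /(e4 sS).
- by split=> // /(e5 sS).
Qed.
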